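(* Let $(X,\mathfrak A,P)$ and $(Y,\mathfrak B,Q)$ be probability spaces, let $\mathbb P=\{(\mathfrak A,P_y):y\in Y\}$ be a regular conditional probability on $\mathfrak A$ with respect to $Q$, and let $R$ be the skew product of $P$ and $Q$ on $\mathfrak A\otimes\mathfrak B$ determined by $\mathbb P$. Let $\Xi=\{\xi_y:y\in Y\}$ be a stochastic process defined on $(X,\mathfrak A,\mathbb P)$. If $(X,\mathfrak A,P)$ is separable in the Fréchet–Nikodým pseudo-metric, then $\{\xi_y:y\in Y\}$ has a $\mathbb P$-equivalent measurable modification if and only if the function $(x,y)\mapsto \xi_y(x)$ is measurable with respect to the $\sigma$-algebra $\mathfrak A\divideontimes_{\mathfrak A}\mathfrak B$.
   Context: For a measure space $(Z,\mathfrak Z,T)$, $(Z,\widehat{\mathfrak Z},\widehat T)$ denotes its completion, and $\mathfrak Z_0=\{A\in\mathfrak Z: T(A)=0\}$. $\mathfrak A\otimes\mathfrak B$ is the product $\sigma$-algebra (generated by the rectangles $A\times B$, $A\in\mathfrak A$, $B\in\mathfrak B$). For $E\subset X\times Y$ and $y\in Y$, $E^y=\{x\in X:(x,y)\in E\}$. Regular conditional probability and skew product: $\mathbb P=\{(\mathfrak A,P_y):y\in Y\}$ is a regular conditional probability (rcp) on $\mathfrak A$ with respect to $Q$ if each $P_y$ is a probability measure on $\mathfrak A$, for every $A\in\mathfrak A$ the function $y\mapsto P_y(A)$ is $\widehat Q$-measurable, and $\int_B P_y(A)\,dQ(y)=R(A\times B)$ for all $A\in\mathfrak A$, $B\in\mathfrak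 B$, where $R$ is a probability measure on $\mathfrak A\otimes\mathfrak B$ having $P$ and $Q$ as its marginals (so in particular $\int_Y P_y(A)\,dQ(y)=P(A)$). The measure $R$ is then given by $R(E)=\int_Y P_y(E^y)\,dQ(y)$ for $E\in\mathfrak A\otimes\mathfrak B$, and is called the skew product of $P$ and $Q$ determined by $\mathbb P$. Processes: a stochastic process $\{\xi_y:y\in Y\}$ on $(X,\mathfrak A,\mathbb P)$ is a family of real functions on $X$ such that each $\xi_y$ is measurable with respect to the $P_y$-completion of $\mathfrak A$. Two processes $\{\xi_y\}$, $\{\theta_y\}$ on $(X,\mathfrak A,\mathbb P)$ are $\mathbb P$-equivalent if $\widehat{P_y}\{x\in X:\xi_y(x)\neq\theta_y(x)\}=0$ for every $y\in Y$. A process $\{\theta_y\}$ is measurable if $(x,y)\mapsto\theta_y(x)$ is $\widehat R$-measurable (measurable with respect to the $R$-completion of $\mathfrak A\otimes\mathfrak B$). A measurable process that is $\mathbb P$-equivalent to $\{\xi_y\}$ is called a ($\mathbb P$-equivalent) measurable modification of $\{\xi_y\}$. The $\sigma$-algebra $\mathfrak A\divideontimes_{\mathfrak A}\mathfrak B$: let $\mathcal M_{\mathfrak A}=\{E\subset X\times Y:\ \exists N\in\mathfrak B_0\ \forall y\notin N\ \ \widehat{P_y}(E^y)=0\}$ (a $\sigma$-ideal). Then $\mathfrak A\divideontimes_{\mathfrak A}\mathfrak B=\{W\triangle N: W\in\mathfrak A\otimes\mathfrak B,\ N\in\mathcal M_{\mathfrak A}\}$. Separable in the Fréchet–Nikodým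 pseudo-metric means that $\mathfrak A$ with the pseudo-metric $d(A,B)=P(A\triangle B)$ is separable. *)

(* Defs.v *)
From HB Require Import structures.
From mathcomp Require Import all_boot all_order all_algebra.
From mathcomp Require Import all_classical all_reals all_analysis.
From mathcomp Require Import measurable_realfun.

Set Implicit Arguments.
Unset Strict Implicit.
Unset Printing Implicit Defensive.
Import Order.TTheory GRing.Theory Num.Theory.
Import numFieldNormedType.Exports.

Local Open Scope classical_set_scope.
Local Open Scope ring_scope.
Local Open Scope ereal_scope.

Section completion.
Context d (T : measurableType d) (R : realType).
Variable mu : {measure set T -> \bar R}.

Lemma sigma_algebra_completed_algebra_gen :
  sigma_algebra [set: T] (completed_algebra_gen mu).
Proof.
split.
- by exists set0 => //; exists set0; [exact: negligible_set0|rewrite setU0].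
- move=> G [/= A mA [N [F [mF F0 NF]] <-]].
  exists (~` (A `|` F)); first by apply: measurableC; exact: measurableU.
  exists (F `\` (A `|` N)); first by exists F; split => // x [].
  rewrite setTD; apply/seteqP; split => x /=.
  + by move=> [/not_orP[a f]|[f]] // [//|/NF].
  + by move=> /not_orP[a n]; have [f|f] := pselect (F x);
      [right; split => // -[]|left => -[]].
- move=> G mG.
  exists (\bigcup_k projT1 (cid2 (mG k))).
    by apply: bigcupT_measurable => k; case: cid2.
  exists (\bigcup_k projT1 (cid2 (projT2 (cid2 (mG k))).2)).
    by apply: negligible_bigcup => k; case: (cid2 (mG k)) => //= *; case: cid2.
  rewrite -bigcupU; apply: eq_bigcup => // k _.
  by case: (cid2 (mG k)) => //= *; case: cid2.
Qed.

(* [T] endowed with the completion, with respect to [mu], of its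
   sigma-algebra (see [completion_measurableE]). *)
Definition completion := g_sigma_algebraType (completed_algebra_gen mu).
HB.instance Definition _ := Measurable.on completion.

Lemma completion_measurableE :
  (measurable : set (set completion)) = completed_algebra_gen mu.
Proof. exact: sigma_algebra_id sigma_algebra_completed_algebra_gen. Qed.

(* The outer measure of [mu], which on the completed sigma-algebra is the
   completion of [mu] (see [completed_measureE]). *)
Definition completed_measure : set completion -> \bar R := (mu^*)%mu.

Lemma negligible_mu_ext0 (N : set T) : mu.-negligible N -> (mu^*)%mu N = 0.
Proof.
move=> [A [mA A0 NA]]; apply/eqP; rewrite eq_le outer_measure_ge0 andbT.
by rewrite -A0 -(measurable_mu_extE mu mA) le_outer_measure.
Qed.

Lemma completion_sub_caratheodory (A : set completion) :
  measurable A -> ((mu^*)%mu).-cara.-measurable A.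
Proof.
rewrite completion_measurableE => -[B mB [N nN <-]]; apply: measurableU.
  by apply: sub_caratheodory; exact: sub_sigma_algebra.
apply: le_caratheodory_measurable => X.
apply: (@le_trans _ _ ((mu^*)%mu N + (mu^*)%mu (X `&` ~` N))).
  by rewrite leeD2r// le_outer_measure//; exact: subIsetr.
by rewrite negligible_mu_ext0// add0e le_outer_measure//; exact: subIsetl.
Qed.

Let completed_measure_set0 : completed_measure set0 = 0.
Proof. exact: mu_ext0. Qed.

Let completed_measure_ge0 A : 0 <= completed_measure A.
Proof. exact: mu_ext_ge0. Qed.

Let completed_measure_semi_sigma_additive :
  semi_sigma_additive completed_measure.
Proof.
move=> F mF tF mUF; apply: caratheodory_measure_sigma_additive => //.
- by move=> k; exact: completion_sub_caratheodory.
- exact: completion_sub_caratheodory.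
Qed.

HB.instance Definition _ := isMeasure.Build _ _ _ completed_measure
  completed_measure_set0 completed_measure_ge0
  completed_measure_semi_sigma_additive.

Lemma completed_measureE (A N : set T) : measurable A -> mu.-negligible N ->
  completed_measure (A `|` N) = mu A.
Proof.
move=> mA nN; rewrite -(measurable_mu_extE mu mA); apply/eqP; rewrite eq_le.
apply/andP; split; last by rewrite le_outer_measure.
apply: (le_trans (outer_measureU2 _ _ _)).
by rewrite [X in _ + X](negligible_mu_ext0 nN) adde0.
Qed.

(* In particular [completed_measure E = 0] forces [E] to belong to the
   completed sigma-algebra, although [completed_measure] is a total function. *)
Lemma completed_measure_eq0 (E : set T) :
  completed_measure E = 0 <-> mu.-negligible E.
Proof.
split; last exact: negligible_mu_ext0.
move=> E0.
have cov (n : nat) : exists2 B : set T, measurable B /\ E `<=` B &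
    mu B < (n.+1%:R^-1)%:E.
  have : (mu^*)%mu E < (n.+1%:R^-1 : R)%:E.
    by rewrite [X in X < _]E0 lte_fin invr_gt0 ltr0n.
  move/ereal_inf_lt => [_ [F [mF EF] <-]] Fn.
  exists (\bigcup_k F k); first by split => //; exact: bigcupT_measurable.
  apply: le_lt_trans Fn; apply: measure_sigma_subadditive => //.
  exact: bigcupT_measurable.
pose B n := s2val (cid2 (cov n)).
have mB n : measurable (B n) by rewrite /B; case: cid2 => ? [].
have mIB : measurable (\bigcap_n B n) by exact: bigcapT_measurable.
exists (\bigcap_n B n); split => //.
- apply/eqP; rewrite eq_le measure_ge0 andbT; apply/lee_addgt0Pr => e e0.
  rewrite add0e.
  have /ltr_add_invr[n] := e0; rewrite add0r => ne.
  apply: (@le_trans _ _ (mu (B n))).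
    by rewrite le_measure ?inE//; exact: bigcap_inf.
  apply: ltW; apply: (@lt_trans _ _ (n.+1%:R^-1)%:E); last by rewrite lte_fin.
  by rewrite /B; case: cid2.
- by move=> x Ex n _; rewrite /B; case: cid2 => C [_ EC] /= _; exact: EC.
Qed.

End completion.
Arguments completed_measure {d T R} mu _.

Section skew_product.
Context d1 d2 (X : measurableType d1) (Y : measurableType d2) (R : realType).

(* [S] is the measure on the product sigma-algebra that occurs in the
   disintegration identity; its marginals are [P] and [Q]. *)
Definition regular_conditional_probability (P : probability X R)
    (Q : probability Y R) (Py : Y -> probability X R) : Prop :=
  (forall A : set X, measurable A ->
    measurable_fun setT (fun y : completion Q => Py y A)) /\
  exists S : probability (X * Y)%type R,
    [/\ forall A : set X, measurable A -> S (A `*` setT) = P A,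
        forall B : set Y, measurable B -> S (setT `*` B) = Q B &
        forall (A : set X) (B : set Y), measurable A -> measurable B ->
          \int[completed_measure Q]_(y in B) Py y A = S (A `*` B)].

Definition skew_product (Q : probability Y R) (Py : Y -> probability X R)
    (S : probability (X * Y)%type R) : Prop :=
  forall E : set (X * Y), measurable E ->
    S E = \int[completed_measure Q]_y Py y (ysection E y).

Definition stochastic_process (Py : Y -> probability X R) (xi : Y -> X -> R) :
    Prop :=
  forall y, measurable_fun setT (xi y : completion (Py y) -> R).

Definition equivalent_processes (Py : Y -> probability X R)
    (xi theta : Y -> X -> R) : Prop :=
  forall y, completed_measure (Py y) [set x | xi y x <> theta y x] = 0.

Definition measurable_process (S : probability (X * Y)%type R)
    (theta : Y -> X -> R) : Prop :=
  measurable_fun setT (fun z : completion S => theta z.2 z.1).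

Definition measurable_modification (Py : Y -> probability X R)
    (S : probability (X * Y)%type R) (xi theta : Y -> X -> R) : Prop :=
  [/\ stochastic_process Py theta, measurable_process S theta &
      equivalent_processes Py xi theta].

Definition sections_null (Q : probability Y R) (Py : Y -> probability X R) :
    set (set (X * Y)) :=
  [set E | exists N : set Y, [/\ measurable N, Q N = 0 &
    forall y, ~ N y -> completed_measure (Py y) (ysection E y) = 0]].

Definition product_mod_sections_null (Q : probability Y R)
    (Py : Y -> probability X R) : set (set (X * Y)) :=
  [set W `+` N | W in (measurable : set (set (X * Y))) &
                 N in sections_null Q Py].

Lemma sigma_algebra_product_mod_sections_null (Q : probability Y R)
    (Py : Y -> probability X R) :
  sigma_algebra [set: X * Y] (product_mod_sections_null Q Py).
Proof.
have nullS E F : E `<=` F -> sections_null Q Py F -> sections_null Q Py E.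
  move=> EF [N [mN N0 NF]]; exists N; split => // y /NF /completed_measure_eq0 h.
  apply/completed_measure_eq0; apply: negligibleS h => x.
  by rewrite /ysection/= !inE => /EF.
have null_bigcup (F : (set (X * Y))^nat) :
    (forall n, sections_null Q Py (F n)) -> sections_null Q Py (\bigcup_n F n).
  move=> nF; exists (\bigcup_n sval (cid (nF n))); split.
  - by apply: bigcupT_measurable => n; case: cid => ? [].
  - apply/negligibleP.
      by apply: bigcupT_measurable => n; case: cid => ? [].
    apply: negligible_bigcup => n; case: cid => N [mN N0 _] /=.
    exact/negligibleP.
  - move=> y Ny; apply/completed_measure_eq0; rewrite ysection_bigcup.
    apply: negligible_bigcup => n; apply/completed_measure_eq0.
    have : ~ sval (cid (nF n)) y by move=> h; apply: Ny; exists n.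
    by case: cid => N [mN N0] /= /[apply].
split.
- exists set0 => //; exists set0; last by rewrite setY0.
  exists set0; split => // y _; rewrite ysection0.
  exact/completed_measure_eq0/negligible_set0.
- move=> G [W mW [N nN <-]]; exists (~` W); first exact: measurableC.
  exists N => //; rewrite setTD; apply/seteqP.
  by split => x /=; have [] := pselect (W x); have [] := pselect (N x); tauto.
- move=> G mG.
  pose W k := projT1 (cid2 (mG k)).
  pose N k := projT1 (cid2 (projT2 (cid2 (mG k))).2).
  have mW k : measurable (W k) by rewrite /W; case: cid2.
  have nN k : sections_null Q Py (N k).
    by rewrite /N; case: (cid2 (mG k)) => //= *; case: cid2.
  have GE k : G k = W k `+` N k.
    by rewrite /W /N; case: (cid2 (mG k)) => //= *; case: cid2.
  exists (\bigcup_k W k); first exact: bigcupT_measurable.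
  exists ((\bigcup_k W k) `+` (\bigcup_k G k)); last first.
    by rewrite setYA setYK set0Y.
  apply: nullS (null_bigcup _ nN) => z [[[k _ Wz] Gz]|[[k _ +] Wz]].
  + exists k => //; apply: contrapT => Nz; apply: Gz; exists k => //.
    by rewrite GE; left.
  + by rewrite GE => -[[w _]|[n _]]; [case: Wz|]; exists k.
Qed.

(* [X * Y] endowed with the sigma-algebra [product_mod_sections_null Q Py];
   that family is a sigma-algebra, so that generating one from it adds no set. *)
Definition extended_product (Q : probability Y R)
    (Py : Y -> probability X R) :=
  g_sigma_algebraType (product_mod_sections_null Q Py).
HB.instance Definition _ (Q : probability Y R) (Py : Y -> probability X R) :=
  Measurable.on (extended_product Q Py).

Lemma extended_product_measurableE (Q : probability Y R)
    (Py : Y -> probability X R) :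
  (measurable : set (set (extended_product Q Py))) =
  product_mod_sections_null Q Py.
Proof. exact: sigma_algebra_id (sigma_algebra_product_mod_sections_null Q Py). Qed.

Definition frechet_nikodym (P : probability X R) (A B : set X) : \bar R :=
  P (A `+` B).

Definition frechet_nikodym_separable (P : probability X R) : Prop :=
  exists D : set (set X), [/\ countable D, D `<=` measurable &
    forall A : set X, measurable A -> forall e : R, (0 < e)%R ->
      exists2 B, D B & frechet_nikodym P A B < e%:E].

End skew_product.

(* Main.v *)
Require Import Defs.
From HB Require Import structures.
From mathcomp Require Import all_boot all_order all_algebra.
From mathcomp Require Import all_classical all_reals all_analysis.
From mathcomp Require Import measurable_realfun.

(** Both measurability notions in the statement have the same form: a
sigma-algebra [M] is enlarged by a sigma-ideal [I], and a set belongs to the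
enlargement when it differs from a member of [M] by a member of [I]. For the
completion of [S] the ideal is that of the [S]-negligible sets; for the extended
product it is [sections_null Q Py]. In this setting a real function is
measurable for the enlargement if and only if it agrees, off a member of [I],
with an [M]-measurable function ([measurable_mod_idealP]): a real number is
determined by the countably many rationals above it, so countably many
corrections from [I] suffice.

Disintegration relates the two ideals. If [S E = 0] with [E] measurable, then
the nonnegative function that sends [y] to the [Py y]-measure of the section of
[E] has integral zero, hence vanishes outside a [Q]-null set: [S]-negligible
sets have null sections ([skew_product_negligible]). The converse may fail for
sets that are not [S]-measurable, but a strip over a [Q]-null set is [S]-null
([skew_product_null_strip]).

If [theta] is a measurable modification of [xi], then [theta] agrees with a
product-measurable [g] off an [S]-negligible set, and [xi] agrees with [theta]
off a set all of whose sections are null; hence [xi] agrees with [g] off a set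
with null sections. Conversely, if [xi] agrees with a product-measurable [g] off
a set whose sections are null for [y] outside a [Q]-null set [N], let [theta y]
be [xi y] for [y] in [N] and [g (_, y)] otherwise. It is equivalent to [xi] at
every [y], and as it differs from [g] only on the strip over [N], it is
measurable for the completion of [S]. *)

Set Implicit Arguments.
Unset Strict Implicit.
Unset Printing Implicit Defensive.
Import Order.TTheory GRing.Theory Num.Theory.

Local Open Scope classical_set_scope.
Local Open Scope ring_scope.
Local Open Scope ereal_scope.

(** * Measurability modulo a sigma-ideal *)

Definition sigma_ideal (T : Type) (I : set (set T)) : Prop :=
  (forall A B, A `<=` B -> I B -> I A) /\
  (forall F : (set T)^nat, (forall n, I (F n)) -> I (\bigcup_n F n)).

Lemma sigma_idealU (T : Type) (I : set (set T)) (A B : set T) :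
  sigma_ideal I -> I A -> I B -> I (A `|` B).
Proof.
move=> [sub bigcup] IA IB; rewrite -bigcup2E; apply: bigcup => -[|[|n]] //=.
exact: sub IA.
Qed.

Lemma sigma_ideal_negligible d (T : measurableType d) (R : realType)
    (mu : {measure set T -> \bar R}) : sigma_ideal mu.-negligible.
Proof.
by split; [move=> A B AB; exact: negligibleS|exact: negligible_bigcup].
Qed.

Lemma inf_rat_cut (R : realType) (a : R) :
  ereal_inf [set (ratr q)%:E | q in [set q : rat | (a < ratr q)%R]] = a%:E.
Proof.
apply/eqP; rewrite eq_le; apply/andP; split.
  apply/lee_addgt0Pr => e e0.
  have [q] : exists q : rat, ratr q \in `]a, (a + e)%R[%R.
    by apply: rat_in_itvoo; rewrite ltrDl.
  rewrite in_itv/= => /andP[aq qe].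
  apply: (@le_trans _ _ (ratr q)%:E); last by rewrite -EFinD lee_fin ltW.
  by apply: ereal_inf_lbound; exists q.
by apply: le_ereal_inf_tmp => _ [q /= aq <-]; rewrite lee_fin ltW.
Qed.

(** For the direct implication, choose for each rational [q] a measurable
set [W] that differs from [set x | f x < q] by a member of [I], and let [g x]
be the infimum of the rationals [q] whose set [W] contains [x]. Outside the
countable union of the differences this set of rationals is the upper cut of
[f x]. *)
Lemma measurable_mod_idealP d (T : measurableType d) (R : realType)
    (I : set (set T)) (f : T -> R) : sigma_ideal I ->
  (forall B : set R, measurable B ->
     exists2 W, measurable W & I (f @^-1` B `+` W)) <->
  (exists2 g : T -> R, measurable_fun setT g & I [set x | f x <> g x]).
Proof.
move=> [subI bigcupI]; split; last first.
  move=> [g mg Ifg] B mB; exists (g @^-1` B).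
    by rewrite -[X in measurable X]setTI; exact: mg.
  apply: subI Ifg => x /= [[Bf Bg] fg|[Bg Bf] fg]; first by rewrite fg in Bf.
  by rewrite -fg in Bg.
move=> fW.
(* The rationals are enumerated by [nat], so that [einfs] applies; the indices
   that encode no rational stand for 0, which only repeats a rational. *)
pose r n : R := ratr (odflt 0%R (unpickle n : option rat)).
have rP (q : rat) : r (pickle q) = ratr q by rewrite /r pickleK.
have /choice[W WP] n : exists V, measurable V /\
    I (f @^-1` [set t | (t < r n)%R] `+` V).
  have mB : measurable [set t : R | (t < r n)%R].
    have -> : [set t : R | (t < r n)%R] = [set` `]-oo, r n[].
      by apply/seteqP; split => t /=; rewrite in_itv.
    exact: measurable_itv.
  by have [V mV IV] := fW _ mB; exists V.
(* The infimum is taken in the extended reals, as off the good set the cut may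
   be empty or unbounded below. *)
pose h n x : \bar R := if x \in W n then (r n)%:E else +oo%E.
have mh n : measurable_fun setT (h n).
  apply: measurable_fun_ifT => //; apply: (measurable_fun_bool true).
  rewrite setTI (_ : _ @^-1` _ = W n); first exact: (WP n).1.
  by apply/seteqP; split => x /=; [move=> /set_mem|move=> /mem_set].
exists (fun x => fine (einfs (h ^~ x) 0%N)).
  apply: measurableT_comp; first exact: fine_measurable.
  exact: measurable_fun_einfs.
apply: subI (bigcupI _ (fun n => (WP n).2)) => x /= fg.
apply: contrapT => Nx; apply: fg.
have WE n : W n x <-> (f x < r n)%R.
  split=> h1; apply: contrapT => h2; apply: Nx; exists n => //.
    by right.
  by left.
rewrite -[f x]/(fine (f x)%:E); congr fine; rewrite -inf_rat_cut.
apply/eqP; rewrite eq_le; apply/andP; split; apply: le_ereal_inf_tmp.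
- move=> _ [n _ <-]; rewrite /h; case: ifPn => [|_]; last exact: leey.
  rewrite inE => /WE fr; apply: ereal_inf_lbound.
  by exists (odflt 0%R (unpickle n : option rat)).
- move=> _ [q fq <-]; apply: ereal_inf_lbound; exists (pickle q) => //=.
  by rewrite /h rP mem_set// WE rP.
Qed.

Lemma completion_measurableP d (T : measurableType d) (R : realType)
    (mu : {measure set T -> \bar R}) (A : set (completion mu)) :
  measurable A <->
  exists2 W : set T, measurable W & mu.-negligible ((A : set T) `+` W).
Proof.
rewrite completion_measurableE; split.
- move=> [W mW [N nN <-]]; exists W => //; apply: negligibleS nN => x.
  by move=> [[[//|//] _ //]|[Wx /not_orP[/(_ Wx)]]].
- move=> [W mW [M [mM M0 WM]]].
  exists (W `\` M); first exact: measurableD.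
  exists ((A : set T) `&` M); first by exists M; split => // x [].
  apply/seteqP; split => x.
  + move=> [[Wx Mx]|[]//]; apply: contrapT => Ax.
    by apply: Mx; apply: WM; right.
  + move=> Ax; have [Mx|Mx] := pselect (M x); first by right.
    by left; split => //; apply: contrapT => Wx; apply: Mx; apply: WM; left.
Qed.

Lemma completion_measurable_funP d (T : measurableType d) (R : realType)
    (mu : {measure set T -> \bar R}) (f : T -> R) :
  measurable_fun setT (f : completion mu -> R) <->
  exists2 g : T -> R, measurable_fun setT g &
    mu.-negligible [set x | f x <> g x].
Proof.
rewrite -(measurable_mod_idealP f (sigma_ideal_negligible mu)); split.
- move=> mf B mB; apply/completion_measurableP.
  by rewrite -[X in measurable X]setTI; exact: mf.
- by move=> fW _ B mB; rewrite setTI; apply/completion_measurableP/fW.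
Qed.

(** * Null sections and the skew product *)

Section skew_product_null_sets.
Context (R : realType) (d1 d2 : measure_display).
Context (X : measurableType d1) (Y : measurableType d2).
Implicit Types (P : probability X R) (Q : probability Y R).
Implicit Types (Py : Y -> probability X R) (S : probability (X * Y)%type R).

Lemma sections_nullP Q Py (E : set (X * Y)) :
  sections_null Q Py E <-> exists2 N : set Y, Q.-negligible N &
    forall y, ~ N y -> (Py y).-negligible (ysection E y).
Proof.
split=> [[N [mN N0 EN]]|[N [M [mM M0 NM]] EN]].
  exists N; first by exists N; split.
  by move=> y /EN /completed_measure_eq0.
exists M; split => // y My; apply/completed_measure_eq0/EN => /NM.
exact: My.
Qed.

Lemma sigma_ideal_sections_null Q Py : sigma_ideal (sections_null Q Py).
Proof.
split=> [A B AB|F].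
  rewrite !sections_nullP => -[N nN BN]; exists N => // y /BN.
  by apply: negligibleS => x; rewrite /ysection/= !inE; exact: AB.
move=> /(_ _)/sections_nullP nF.
have /choice[N NP] n : exists N, Q.-negligible N /\
    forall y, ~ N y -> (Py y).-negligible (ysection (F n) y).
  by have [N nN NF] := nF n; exists N.
apply/sections_nullP; exists (\bigcup_n N n).
  by apply: negligible_bigcup => n; exact: (NP n).1.
move=> y Ny; rewrite ysection_bigcup; apply: negligible_bigcup => n.
by apply: (NP n).2 => Nny; apply: Ny; exists n.
Qed.

Lemma extended_product_measurable_funP Q Py (f : X * Y -> R) :
  measurable_fun setT (f : extended_product Q Py -> R) <->
  exists2 g : X * Y -> R, measurable_fun setT g &
    sections_null Q Py [set z | f z <> g z].
Proof.
rewrite -(measurable_mod_idealP f (sigma_ideal_sections_null Q Py)).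
have mE (A : set (extended_product Q Py)) : measurable A <->
    exists2 W : set (X * Y), measurable W &
      sections_null Q Py ((A : set (X * Y)) `+` W).
  rewrite extended_product_measurableE; split => [[W mW [N nN <-]]|[W mW nAW]].
    by exists W => //; rewrite [_ `+` W]setYC setYA setYK set0Y.
  by exists W => //; exists (A `+` W) => //; rewrite setYC -setYA setYK setY0.
split.
- by move=> mf B mB; apply/mE; rewrite -[X in measurable X]setTI; exact: mf.
- by move=> fW _ B mB; rewrite setTI; apply/mE/fW.
Qed.

Section measurable_ysection_rcp.
Variables (Q : probability Y R) (Py : Y -> probability X R).
Hypothesis mPy : forall A : set X, measurable A ->
  measurable_fun setT (fun y : completion Q => Py y A).

(** The family [Py], seen as a kernel from the completion of [Y]. The
otherwise vacuous [let] makes the term depend on [mPy], which the kernel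
structure on it needs. *)
Definition rcp_kernel : completion Q -> {measure set X -> \bar R} :=
  let _ := mPy in fun y => Py y.

HB.instance Definition _ := isKernel.Build _ _ _ _ _ rcp_kernel mPy.

Let rcp_kernelT y : rcp_kernel y setT = 1.
Proof. exact: probability_setT. Qed.

HB.instance Definition _ :=
  Kernel_isProbability.Build _ _ _ _ _ rcp_kernel rcp_kernelT.

Lemma measurable_rcp_ysection (E : set (X * Y)) : measurable E ->
  measurable_fun setT (fun y : completion Q => Py y (ysection E y)).
Proof.
move=> mE.
pose swapE : set (completion Q * X) := [set z | E (z.2, z.1)].
have mswap : measurable_fun setT (fun z : completion Q * X => (z.2, z.1 : Y)).
  apply: measurable_fun_pair; first exact: measurable_snd.
  move=> _ B mB; rewrite setTI.
  rewrite (_ : _ @^-1` _ = (B : set (completion Q)) `*` setT).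
    apply: measurableX => //; apply/completion_measurableP.
    by exists B => //; rewrite setYK; exact: negligible_set0.
  by apply/seteqP; split => // z [].
have := @measurable_fun_xsection_finite_kernel _ _ _ _ _ rcp_kernel swapE.
rewrite inE => /(_ _); apply => //.
by rewrite /swapE -[X in measurable X]setTI; exact: mswap.
Qed.

End measurable_ysection_rcp.

(** The measurability of [y |-> Py y (ysection F y)] is what allows to infer,
from a zero integral, that almost all sections are null. *)
Lemma skew_product_negligible P Q Py S (E : set (X * Y)) :
  regular_conditional_probability P Q Py -> skew_product Q Py S ->
  S.-negligible E -> sections_null Q Py E.
Proof.
move=> [mPy _] SE [F [mF F0 EF]].
apply: (sigma_ideal_sections_null Q Py).1 EF _.
have := SE F mF; rewrite F0.
under eq_integral do rewrite -(gee0_abs (measure_ge0 _ _)).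
have mPyF := measurable_rcp_ysection mPy mF.
move=> /esym /(ae_eq_integral_abs _ measurableT mPyF) [A [mA A0 FA]].
apply/sections_nullP; exists A; first exact/completed_measure_eq0.
move=> y Ay; apply/negligibleP; first exact: measurable_ysection.
by apply: contrapT => Fy; apply: Ay; apply: FA => /= /(_ I).
Qed.

Lemma skew_product_null_strip P Q Py S (N : set Y) :
  skew_product Q Py S -> measurable N -> Q N = 0 ->
  S (setT `*` N) = 0.
Proof.
move=> SE mN N0; rewrite SE; last exact: measurableX.
have QN0 : completed_measure Q N = 0.
  exact/completed_measure_eq0/negligibleP.
under eq_integral => y _ .
  rewrite (_ : Py y _ = (\1_(N : set (completion Q)) y)%:E); last first.
    rewrite indicE; have [yN|yN] := boolP (y \in N).
      by rewrite in_ysectionX// probability_setT.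
    by rewrite notin_ysectionX// measure0.
  over.
rewrite integral_indic ?setIT//.
apply/completion_measurableP; exists N => //.
by rewrite setYK; exact: negligible_set0.
Qed.

End skew_product_null_sets.

(** * Measurable modifications *)

Theorem theorem2p2 (R : realType) (d1 d2 : measure_display)
    (X : measurableType d1) (Y : measurableType d2)
    (P : probability X R) (Q : probability Y R)
    (Py : Y -> probability X R) (S : probability (X * Y)%type R)
    (xi : Y -> X -> R) :
  regular_conditional_probability P Q Py ->
  skew_product Q Py S ->
  stochastic_process Py xi ->
  frechet_nikodym_separable P ->
  (exists theta : Y -> X -> R, measurable_modification Py S xi theta) <->
  measurable_fun setT (fun z : extended_product Q Py => xi z.2 z.1).
Proof.
move=> rcpPy SE mxi _; split.
- move=> [theta [_ mtheta xitheta]].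
  apply/(extended_product_measurable_funP Q Py (fun z => xi z.2 z.1)).
  have [g mg /(skew_product_negligible rcpPy SE) nthetag] :=
    (completion_measurable_funP S (fun z => theta z.2 z.1)).1 mtheta.
  exists g => //.
  have nxitheta : sections_null Q Py [set z | xi z.2 z.1 <> theta z.2 z.1].
    exists set0; split => // y _; rewrite -(xitheta y); congr completed_measure.
    by apply/seteqP; split => x; rewrite /ysection/= inE.
  have idealN := sigma_ideal_sections_null Q Py.
  apply: idealN.1 (sigma_idealU idealN nxitheta nthetag) => z /= xig.
  have [xit|?] := pselect (xi z.2 z.1 = theta z.2 z.1); last by left.
  by right; rewrite -xit.
- move=> /(extended_product_measurable_funP Q Py (fun z => xi z.2 z.1)).
  move=> [g mg [N [mN N0 xig]]].
  exists (fun y x => if y \in N then xi y x else g (x, y)); split.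
  + move=> y; have [yN|yN] := boolP (y \in N).
      exact: mxi.
    apply/(completion_measurable_funP (Py y)); exists (fun x => g (x, y)).
      exact: measurableT_comp.
    rewrite (_ : [set x | _] = set0); first exact: negligible_set0.
    by apply/seteqP; split.
  + apply/(completion_measurable_funP S
      (fun z => if z.2 \in N then xi z.2 z.1 else g (z.1, z.2))).
    exists g => //; exists (setT `*` N); split.
    * exact: measurableX.
    * exact: skew_product_null_strip SE mN N0.
    * move=> [x y] /=; have [yN _|_ /(_ erefl)//] := boolP (y \in N).
      by split=> //; rewrite inE in yN.
  + move=> y; apply/completed_measure_eq0.
    have [yN|yN] := boolP (y \in N).
      rewrite (_ : [set x | _] = set0); first exact: negligible_set0.
      by apply/seteqP; split.
    have /completed_measure_eq0 : completed_measure (Py y)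
        (ysection [set z | xi z.2 z.1 <> g z] y) = 0%R.
      by apply: xig => /mem_set; exact/negP.
    by apply: negligibleS => x xig'; exact: mem_set.
Qed.
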